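(* Every constant angle spacelike surface in $\mathbf{E}_1^3$ is flat, i.e. the Gaussian curvature of its induced metric vanishes identically.
   Context: $\mathbf{E}_1^3$ is $\mathbb{R}^3$ with the Lorentzian metric $\langle\,,\rangle=dx_1^2+dx_2^2-dx_3^2$. A vector $w$ is timelike if $\langle w,w\rangle<0$, and $|w|=\sqrt{|\langle w,w\rangle|}$. A timelike vector $w$ is future-directed if $\langle w,(0,0,1)\rangle<0$. For timelike $a,b$ in the same timelike cone ($\langle a,b\rangle<0$) the hyperbolic angle is the unique $\theta\ge 0$ with $\langle a,b\rangle=-|a||b|\cosh\theta$. A smooth immersion $x:M\to\mathbf{E}_1^3$ of a connected surface is spacelike if the induced metric is Riemannian; equivalently its unit normal fields are timelike. The unit normal field $\xi$ is chosen future-directed. $M$ is a constant angle (spacelike) surface if there is a fixed timelike vector $U$ (taken unit and future-directed) such that $\xi$ makes a constant hyperbolic angle with $U$. *)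

(* Defs.v *)
From mathcomp Require Import all_boot all_order all_algebra.
From mathcomp Require Import all_classical all_reals all_analysis.
Set Implicit Arguments.
Unset Strict Implicit.
Unset Printing Implicit Defensive.
Import Order.TTheory GRing.Theory Num.Theory.
Import numFieldNormedType.Exports.
Local Open Scope classical_set_scope.
Local Open Scope ring_scope.

(** ** Smooth maps and smooth surfaces *)

Section Smooth.
Variables (R : realType) (V W : normedModType R).

(* [Cn n D f]: f is of class C^n at every point of D.  The derivatives are
   total functions, so D is meant to be open. *)
Fixpoint Cn (n : nat) (D : set V) (f : V -> W) : Prop :=
  if n is m.+1 then
    (forall q, D q -> differentiable f q) /\
    (forall v, Cn m D (fun q => 'D_v f q))
  else forall q, D q -> {for q, continuous f}.

Definition smooth_on (D : set V) (f : V -> W) : Prop := forall n, Cn n D f.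

End Smooth.

(* A homeomorphism from an open subset of M onto an open subset of R^2; both
   directions are total functions whose values outside are irrelevant. *)
Record chart (R : realType) (M : topologicalType) := Chart {
  chart_dom : set M;
  chart_cod : set 'rV[R]_2;
  chart_map : M -> 'rV[R]_2;
  chart_inv : 'rV[R]_2 -> M;
  chart_dom_open : open chart_dom;
  chart_cod_open : open chart_cod;
  chart_mapP : forall p, chart_dom p -> chart_cod (chart_map p);
  chart_invP : forall q, chart_cod q -> chart_dom (chart_inv q);
  chart_mapK : forall p, chart_dom p -> chart_inv (chart_map p) = p;
  chart_invK : forall q, chart_cod q -> chart_map (chart_inv q) = q;
  chart_map_continuous :
    forall p, chart_dom p -> {for p, continuous chart_map};
  chart_inv_continuous :
    forall q, chart_cod q -> {for q, continuous chart_inv}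
}.

(* The atlas is not required to be maximal. *)
Record smooth_surface (R : realType) := SmoothSurface {
  surf_space :> topologicalType;
  surf_hausdorff : hausdorff_space surf_space;
  surf_second_countable : @second_countable surf_space;
  atlas : set (chart R surf_space);
  atlas_cover : forall p, exists2 c, atlas c & chart_dom c p;
  atlas_compatible : forall c d, atlas c -> atlas d ->
    smooth_on (chart_cod c `&` chart_inv c @^-1` chart_dom d)
              (chart_map d \o chart_inv c)
}.

(** ** Minkowski space *)

Section Minkowski.
Variable R : realType.
Implicit Types a b w : 'rV[R]_3.

(* The coordinates x_1, x_2, x_3 have indices 0, 1, 2. *)
Definition lorentz a b : R :=
  a 0 0 * b 0 0 + a 0 1 * b 0 1 - a 0 2%:R * b 0 2%:R.

Definition timelike w : Prop := lorentz w w < 0.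

Definition lnorm w : R := Num.sqrt `|lorentz w w|.

Definition e3 : 'rV[R]_3 := delta_mx 0 2%:R.

Definition future_directed w : Prop := timelike w /\ lorentz w e3 < 0.

Definition cosh (t : R) : R := (expR t + expR (- t)) / 2.

(* For timelike a and b in the same timelike cone there is exactly one such
   theta. *)
Definition hyperbolic_angle a b (theta : R) : Prop :=
  [/\ timelike a, timelike b, lorentz a b < 0, 0 <= theta &
      lorentz a b = - (lnorm a * lnorm b * cosh theta)].

End Minkowski.

(** ** Intrinsic curvature of a metric on a planar domain *)

Section Curvature.
Variable R : realType.

(* The partial derivative in the i-th coordinate. *)
Definition pd (i : 'I_2) (f : 'rV[R]_2 -> R) (q : 'rV[R]_2) : R :=
  'D_(delta_mx 0 i) (f : 'rV[R]_2 -> R^o) q.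

Variable g : 'rV[R]_2 -> 'M[R]_2.

(* [christoffel k i j] is Gamma^k_{ij}. *)
Definition christoffel (k i j : 'I_2) (q : 'rV[R]_2) : R :=
  2^-1 * \sum_(l < 2) invmx (g q) k l *
    (pd i (fun z => g z j l) q + pd j (fun z => g z i l) q
     - pd l (fun z => g z i j) q).

(* [riemann l k i j] is the coefficient of the l-th coordinate field in
   nabla_i nabla_j d_k - nabla_j nabla_i d_k. *)
Definition riemann (l k i j : 'I_2) (q : 'rV[R]_2) : R :=
  pd i (christoffel l j k) q - pd j (christoffel l i k) q
  + \sum_(m < 2) (christoffel l i m q * christoffel m j k q
                  - christoffel l j m q * christoffel m i k q).

(* K = g(R(d_1, d_2) d_2, d_1) / (g_11 g_22 - g_12^2) *)
Definition gauss_curvature (q : 'rV[R]_2) : R :=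
  (\sum_(l < 2) g q l 0 * riemann l 1 0 1 q) / \det (g q).

End Curvature.

(** ** Surfaces in Minkowski space *)

Section Surfaces.
Variables (R : realType) (M : smooth_surface R) (x : M -> 'rV[R]_3).

(* The expression of x in the chart c. *)
Definition local_expr (c : chart R M) : 'rV[R]_2 -> 'rV[R]_3 :=
  x \o chart_inv c.

(* The library's Jacobian acts on row vectors: its i-th row is the derivative
   in the i-th coordinate. *)
Definition smooth_immersion : Prop :=
  forall c, atlas c ->
    smooth_on (chart_cod c) (local_expr c) /\
    forall q, chart_cod c q -> row_free (jacobian (local_expr c) q).

Definition induced_metric (c : chart R M) (q : 'rV[R]_2) : 'M[R]_2 :=
  \matrix_(i, j) lorentz (row i (jacobian (local_expr c) q))
                         (row j (jacobian (local_expr c) q)).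

Definition spacelike : Prop :=
  forall c, atlas c -> forall q, chart_cod c q ->
    forall v : 'rV[R]_2, v != 0 -> 0 < (v *m induced_metric c q *m v^T) 0 0.

(* These conditions determine xi on a spacelike surface, so smoothness of xi
   is automatic and is not part of the definition. *)
Definition future_unit_normal (xi : M -> 'rV[R]_3) : Prop :=
  (forall p, lnorm (xi p) = 1 /\ future_directed (xi p)) /\
  (forall c, atlas c -> forall q, chart_cod c q ->
    forall v : 'rV[R]_2,
      lorentz (xi (chart_inv c q)) (v *m jacobian (local_expr c) q) = 0).

Definition constant_angle : Prop :=
  exists (xi : M -> 'rV[R]_3) (U : 'rV[R]_3) (theta : R),
    [/\ future_unit_normal xi, lnorm U = 1, future_directed U &
        forall p, hyperbolic_angle (xi p) U theta].

Definition flat : Prop :=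
  forall c, atlas c -> forall q, chart_cod c q ->
    gauss_curvature (induced_metric c) q = 0.

End Surfaces.

(* Main.v *)
(* Everything is local in a chart.  Let F_i be the partial derivatives of the
   parametrization, g the induced metric, n the Lorentzian cross product of F_1
   and F_2, so that <n, n> = - det g, and h_ij = <n, F_ij>.  The Gauss equation
   reads K (det g)^2 = h_12^2 - h_11 h_22.  The unit normal being a multiple of
   n, the constant angle gives <n, U>^2 = C det g with C constant; this relation
   is polynomial in the F_i, so no smoothness of the unit normal is needed to
   differentiate it, and it shows that the tangential part of U is in the kernel
   of h.  If that part is not zero then det h = 0; if it vanishes somewhere then
   it vanishes everywhere, U is normal and h = 0. *)
Require Import Defs.
From mathcomp Require Import all_boot all_order all_algebra.
From mathcomp Require Import all_classical all_reals all_analysis.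
From mathcomp Require Import ring lra.
Set Implicit Arguments.
Unset Strict Implicit.
Unset Printing Implicit Defensive.
Import Order.TTheory GRing.Theory Num.Theory.
Import numFieldNormedType.Exports.
Local Open Scope classical_set_scope.
Local Open Scope ring_scope.

(** * Symmetry of mixed second derivatives *)

(** Both difference quotients are the same function of [h]. This makes the one-variable mean value
    theorem available for directional derivatives. *)
Lemma is_derive_line (R : realType) (V : normedModType R) (f : V -> R)
    (p u : V) (s l : R) :
  is_derive (p + s *: u) u f l ->
  is_derive s (1 : R) (fun r : R => f (p + r *: u)) l.
Proof.
have E : (fun h : R => h^-1 *:
      (((fun r : R => f (p + r *: u)) \o shift s) (h *: 1) - f (p + s *: u)))
    = (fun h : R => h^-1 *:
      ((f \o shift (p + s *: u)) (h *: u) - f (p + s *: u))).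
  apply/funext => h /=; congr (_ *: (f _ - _)).
  by rewrite [h *: 1]mulr1 scalerDl addrCA.
case=> df <-; apply: DeriveDef.
  by rewrite /derivable E.
by rewrite /derive E.
Qed.

(* By the mean value theorem in the direction u, the difference equals
   t (fu (q + s u + t v) - fu (q + s u)) for some s in [0, t]; then expand fu
   to first order at q. *)
Lemma second_difference (R : realType) (V : normedModType R) (f fu : V -> R)
    (D : set V) (q u v : V) :
  open D -> D q -> (forall z, D z -> is_derive z u f (fu z)) ->
  differentiable fu q -> forall e : R, 0 < e ->
  \forall t \near 0^'+,
    `|f (q + t *: u + t *: v) - f (q + t *: u) - f (q + t *: v) + f q
      - t ^+ 2 * 'D_v fu q| <= e * t ^+ 2.
Proof.
move=> oD Dq fuP dfu e e0.
(* The increments s u + t v and s u, at which [fu] is expanded, have norms adding up to at most t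
   (2|u| + |v|); the 1 makes [C] positive. *)
pose C := `|u| + `|u| + `|v| + 1.
have C0 : 0 < C by rewrite ltr_wpDl// !addr_ge0.
have Nu : 0 <= `|u| by []. have Nv : 0 <= `|v| by [].
have /diff_locally/eqaddoP/(_ (e / C)) := dfu.
rewrite divr_gt0// => /(_ isT) near1.
have near2 : \forall k \near (0 : V), D (k + q).
  have : \near q, D q by exact: open_nbhs_nbhs.
  by rewrite (near_shift 0) subr0.
have [d /= d0 dP] : nbhs_ball (0 : V) [set k |
    `|(fu \o shift q - (cst (fu q) + 'd fu q)) k| <= e / C * `|k| /\ D (k + q)].
  by apply/nbhs_ballP; exact: filterI near1 near2.
have dP1 k : `|k| < d -> `|fu (k + q) - fu q - 'd fu q k| <= e / C * `|k|.
  move=> kd; have [] := dP k.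
    by rewrite -ball_normE/= sub0r normrN.
  by rewrite -[X in X <= _]/(`| fu (k + q) - (fu q + 'd fu q k) |) opprD addrA.
have dP2 k : `|k| < d -> D (k + q).
  move=> kd; have [] // := dP k.
  by rewrite -ball_normE/= sub0r normrN.
have dC : 0 < d / C by exact: divr_gt0.
near=> t.
have t0 : 0 < t by [].
have td : t * C < d.
  by rewrite -ltr_pdivlMr//; near: t; apply: nbhs_right_lt.
have small s (b : R) : 0 <= s <= t -> 0 <= b <= t -> `|s *: u + b *: v| < d.
  move=> /andP[s0 st] /andP[b0 bt]; apply: le_lt_trans td.
  rewrite (le_trans (ler_normD _ _))// !normrZ !ger0_norm// /C.
  by rewrite !mulrDr; nra.
pose h (s : R) := f ((q + t *: v) + s *: u) - f (q + s *: u).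
have dh s : 0 <= s <= t ->
    is_derive s (1 : R) h (fu ((q + t *: v) + s *: u) - fu (q + s *: u)).
  move=> st; apply: is_deriveB; apply: is_derive_line; apply: fuP.
    rewrite -addrA addrC [_ *: v + _]addrC; apply/dP2/small => //.
    by rewrite lexx ltW.
  rewrite addrC; apply: dP2; have := small _ 0 st.
  by rewrite scale0r addr0 lexx (ltW t0); exact.
have [s /itvP st ht] : exists2 s : R, s \in `]0, t[ &
    h t - h 0 = (fu ((q + t *: v) + s *: u) - fu (q + s *: u)) * (t - 0).
  apply: MVT => // [s /itvP st|]; first by apply: dh; rewrite !st.
  apply: derivable_within_continuous => s /itvP st.
  by have [] : is_derive s (1 : R) h _ := dh s _; rewrite ?st.
have st' : 0 <= s <= t by rewrite !st.
have -> : f (q + t *: u + t *: v) - f (q + t *: u) - f (q + t *: v) + f q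
     = h t - h 0.
  by rewrite /h !scale0r !addr0 -!addrA [t *: v + _]addrC; ring.
rewrite ht subr0 deriveE//.
(* By linearity of the differential, what remains is t times a difference of two first-order
   remainders. *)
have -> : (fu (q + t *: v + s *: u) - fu (q + s *: u)) * t - t ^+ 2 * 'd fu q v
  = t * ((fu ((s *: u + t *: v) + q) - fu q - 'd fu q (s *: u + t *: v))
        - (fu (s *: u + q) - fu q - 'd fu q (s *: u))).
  have -> : 'd fu q (s *: u + t *: v) = s * 'd fu q u + t * 'd fu q v.
    by rewrite linearD !linearZ.
  have -> : 'd fu q (s *: u) = s * 'd fu q u by rewrite linearZ.
  rewrite [s *: u + q]addrC.
  have -> : s *: u + t *: v + q = q + t *: v + s *: u.
    by rewrite addrC [_ *: u + _]addrC addrA.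
  ring.
rewrite normrM gtr0_norm// expr2 mulrCA ler_pM2l//.
rewrite (le_trans (ler_normB _ _))//.
have tt : 0 <= t <= t by rewrite lexx (ltW t0).
have zt : 0 <= (0 : R) <= t by rewrite lexx ltW.
have b1 := dP1 _ (small _ _ st' tt).
have := dP1 _ (small _ _ st' zt); rewrite scale0r addr0 => b2.
rewrite (le_trans (lerD b1 b2))// -mulrDr -mulrA ler_pM2l//.
rewrite mulrC ler_pdivrMr//.
rewrite (@le_trans _ _ (s * `|u| + t * `|v| + s * `|u|))//.
  rewrite lerD//; last by rewrite normrZ ger0_norm//; case/andP: st'.
  rewrite (le_trans (ler_normD _ _))// !normrZ !ger0_norm ?(ltW t0)//.
  by case/andP: st'.
rewrite /C; case/andP: st' => s0 s1; nra.
Unshelve. all: by end_near. Qed.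

(** The second difference of [f] is symmetric in [u] and [v], and t^2 times either mixed derivative
    approximates it within (e/2) t^2. *)
Theorem young (R : realType) (V : normedModType R) (f fu fv : V -> R)
    (D : set V) (q u v : V) :
  open D -> D q ->
  (forall z, D z -> is_derive z u f (fu z)) ->
  (forall z, D z -> is_derive z v f (fv z)) ->
  differentiable fu q -> differentiable fv q ->
  'D_v fu q = 'D_u fv q.
Proof.
move=> oD Dq fuP fvP dfu dfv.
apply/eqP; rewrite -subr_eq0 -normr_le0.
apply/ler_addgt0Pr => e e0; rewrite add0r.
have e2 : 0 < e / 2 by rewrite divr_gt0.
have n1 := second_difference v oD Dq fuP dfu e2.
have n2 := second_difference u oD Dq fvP dfv e2.
near (0 : R)^'+ => t.
have t0 : 0 < t by [].
have : `|f (q + t *: u + t *: v) - f (q + t *: u) - f (q + t *: v) + f q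
      - t ^+ 2 * 'D_v fu q| <= e / 2 * t ^+ 2 by near: t.
have : `|f (q + t *: v + t *: u) - f (q + t *: v) - f (q + t *: u) + f q
      - t ^+ 2 * 'D_u fv q| <= e / 2 * t ^+ 2 by near: t.
have -> : q + t *: v + t *: u = q + t *: u + t *: v by rewrite addrAC.
rewrite ![`| _ - _ * _ |]distrC => b1; rewrite distrC => b2.
have t20 : 0 < t ^+ 2 by rewrite exprn_gt0.
rewrite -(ler_pM2l t20) -[X in X * `|_|]gtr0_norm// -normrM.
set A := f (q + _ + _) in b1 b2.
set B := f (q + _) in b1 b2; set B' := f (q + _) in b1 b2.
move: b1 b2; rewrite !ler_norml => /andP[b1 b1'] /andP[b2 b2'].
by apply/andP; split; lra.
Unshelve. all: by end_near. Qed.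

(** * Lorentzian products and normals *)

(** The determinant with rows [a], [b], [w], expanded along [a]. *)
Definition triple (R : realType) (a b w : 'rV[R]_3) : R :=
  a 0 0 * (b 0 1 * w 0 2%:R - b 0 2%:R * w 0 1)
  - a 0 1 * (b 0 0 * w 0 2%:R - b 0 2%:R * w 0 0)
  + a 0 2%:R * (b 0 0 * w 0 1 - b 0 1 * w 0 0).

Lemma lorentzC (R : realType) (a b : 'rV[R]_3) : lorentz a b = lorentz b a.
Proof. by rewrite /lorentz; ring. Qed.

(* [triple a b w] is the Lorentzian product of w with a normal n of the plane
   spanned by a and b, and [lorentz n n] is minus the Gram determinant of a, b;
   this is the expansion of [lorentz w z] in the basis a, b, n. *)
Lemma lorentz_gram (R : realType) (a b w z : 'rV[R]_3) :
  (lorentz a a * lorentz b b - lorentz a b ^+ 2) * lorentz w z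
    + triple a b w * triple a b z
  = lorentz b b * (lorentz w a * lorentz z a)
    - lorentz a b * (lorentz w a * lorentz z b + lorentz w b * lorentz z a)
    + lorentz a a * (lorentz w b * lorentz z b).
Proof. by rewrite /lorentz /triple; ring. Qed.

(* The expansion of [lorentz_gram] applied to U and the derivative of the
   normal of the plane spanned by a and b, when a and b have derivatives
   a' and b'. *)
Lemma triple_gram (R : realType) (a b a' b' U : 'rV[R]_3) :
  (lorentz a a * lorentz b b - lorentz a b ^+ 2)
      * (triple a' b U + triple a b' U)
  - (lorentz a' a * lorentz b b + lorentz a a * lorentz b' b
     - lorentz a b * (lorentz a' b + lorentz a b')) * triple a b U
  = - (triple a b a' * (lorentz b b * lorentz U a - lorentz a b * lorentz U b)
       + triple a b b'
         * (lorentz a a * lorentz U b - lorentz a b * lorentz U a)).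
Proof. by rewrite /lorentz /triple; ring. Qed.

(** * Differentiation rules *)

Lemma is_derive_mul (R : realType) (V : normedModType R) (f g : V -> R)
    (df dg : R) (q v : V) :
  is_derive q v f df -> is_derive q v g dg ->
  is_derive q v (fun z => f z * g z) (df * g q + f q * dg).
Proof.
move=> hf hg; apply: is_derive_eq (is_deriveM hf hg) _.
by rewrite addrC [df * _]mulrC.
Qed.

Lemma is_derive_coord (R : realType) (V : normedModType R) m n
    (a : V -> 'M[R]_(m, n)) da (q v : V) i j :
  is_derive q v a da -> is_derive q v (fun z => a z i j : R) (da i j).
Proof.
move=> [ad <-]; apply: DeriveDef; first by move/derivable_mxP: ad.
by rewrite derive_mx// mxE.
Qed.

Lemma is_derive_lorentz (R : realType) (V : normedModType R)
    (a b : V -> 'rV[R]_3) da db (q v : V) :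
  is_derive q v a da -> is_derive q v b db ->
  is_derive q v (fun z => lorentz (a z) (b z))
    (lorentz da (b q) + lorentz (a q) db).
Proof.
move=> ha hb.
have ca k := is_derive_coord 0 k ha.
have cb k := is_derive_coord 0 k hb.
have H := is_deriveB (is_deriveD (is_derive_mul (ca 0) (cb 0))
  (is_derive_mul (ca 1) (cb 1))) (is_derive_mul (ca 2%:R) (cb 2%:R)).
by apply: is_derive_eq H _; rewrite /lorentz; ring.
Qed.

Lemma is_derive_triple (R : realType) (V : normedModType R)
    (a b : V -> 'rV[R]_3) da db (U : 'rV[R]_3) (q v : V) :
  is_derive q v a da -> is_derive q v b db ->
  is_derive q v (fun z => triple (a z) (b z) U)
    (triple da (b q) U + triple (a q) db U).
Proof.
move=> ha hb.
have ca k := is_derive_coord 0 k ha.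
have cb k := is_derive_coord 0 k hb.
have mn i j k : is_derive q v (fun z => a z 0 i * (b z 0 j * U 0 k) : R)
   (da 0 i * (b q 0 j * U 0 k) + a q 0 i * (db 0 j * U 0 k)).
  have H := is_derive_mul (ca i)
    (is_derive_mul (cb j) (is_derive_cst (U 0 k) q v)).
  by apply: is_derive_eq H _; rewrite mulr0 addr0.
have H := is_deriveD (is_deriveB (is_deriveB (mn 0 1 2%:R) (mn 0 2%:R 1))
  (is_deriveB (mn 1 0 2%:R) (mn 1 2%:R 0))) 
  (is_deriveB (mn 2%:R 0 1) (mn 2%:R 1 0)).
apply: is_derive_eq (near_eq_is_derive _ H) _.
  by apply: nearW => z; rewrite /triple !fctE; ring.
by rewrite /triple; ring.
Qed.

Lemma derive_commute (R : realType) (V : normedModType R) (m n : nat)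
    (F : V -> 'M[R]_(m, n)) (D : set V) (q u v : V) :
  open D -> D q -> (forall z, D z -> differentiable F z) ->
  (forall w, differentiable ('D_w F) q) ->
  'D_v ('D_u F) q = 'D_u ('D_v F) q.
Proof.
move=> oD Dq dF ddF; apply/matrixP => i j.
have part w z : D z -> is_derive z w (fun z => F z i j : R) ('D_w F z i j).
  move=> Dz; apply: is_derive_coord; apply: derivableP.
  exact/diff_derivable/dF.
have coordd w : differentiable (fun z => 'D_w F z i j : R) q.
  apply: (differentiable_comp (g := fun N : 'M[R]_(m, n) => N i j : R)) => //.
  exact: differentiable_coord.
have E w w' : 'D_w (fun z => 'D_w' F z i j : R) q = 'D_w ('D_w' F) q i j.
  have dw := derivableP (diff_derivable (v := w) (ddF w')).
  by have [_ ->] := is_derive_coord i j dw.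
have Y := young oD Dq (part u) (part v) (coordd u) (coordd v).
exact: etrans (esym (E v u)) (etrans Y (E u v)).
Qed.


(** * The Gauss equation *)

Lemma big_ord2 (R : nmodType) (f : 'I_2 -> R) : \sum_(i < 2) f i = f 0 + f 1.
Proof.
rewrite !big_ord_recl big_ord0 addr0.
by congr (f _ + f _); exact: val_inj.
Qed.

Lemma det_mx2 (R : comPzRingType) (A : 'M[R]_2) :
  \det A = A 0 0 * A 1 1 - A 0 1 * A 1 0.
Proof.
rewrite (expand_det_row _ 0) big_ord2 /cofactor !det_mx11 !mxE /=.
rewrite expr0 expr1; have -> : lift 0 0 = 1 :> 'I_2 by apply/val_inj.
have -> : lift 1 0 = 0 :> 'I_2 by apply/val_inj.
by ring.
Qed.

(* E, M, G stand for the coefficients of the metric; u, v, v', w for the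
   Christoffel symbols with lower indices 00, 01, 10, 11; p and r for the
   derivatives of w and v; x, y, z for the products of the second derivatives
   of the parametrization with its first ones; h, k, l for the second
   fundamental form. *)
Lemma gauss_algebra (R : comPzRingType) (E M G u0 u1 v0 v1 v0' v1' w0 w1 p0 p1
    r0 r1 x0 x1 y0 y1 z0 z1 t S Q h k l : R) :
  E * p0 + M * p1 = t + S - ((x0 + x0) * w0 + (x1 + y0) * w1) ->
  E * r0 + M * r1 = t + Q - ((y0 + y0) * v0 + (y1 + z0) * v1) ->
  E * u0 + M * u1 = x0 -> E * v0 + M * v1 = y0 -> E * v0' + M * v1' = y0 ->
  E * w0 + M * w1 = z0 -> M * v0 + G * v1 = y1 -> M * w0 + G * w1 = z1 ->
  (E * G - M ^+ 2) * S + h * l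
    = G * (x0 * z0) - M * (x0 * z1 + x1 * z0) + E * (x1 * z1) ->
  (E * G - M ^+ 2) * Q + k * k
    = G * (y0 * y0) - M * (y0 * y1 + y1 * y0) + E * (y1 * y1) ->
  (E * (p0 - r0 + (u0 * w0 - v0' * v0 + (v0 * w1 - w0 * v1)))
   + M * (p1 - r1 + (u1 * w0 - v1' * v0 + (v1 * w1 - w1 * v1))))
    * (E * G - M * M) = k ^+ 2 - h * l.
Proof.
move=> A B G00 G01 G10 G11 H01 H11 gA gB.
apply/eqP; rewrite -subr_eq0; apply/eqP.
(* An explicit combination of the hypotheses, each written as a difference that vanishes; the
   third-derivative term [t] cancels between the first two. *)
transitivity ((E * G - M ^+ 2) *
  ((E * p0 + M * p1 - (t + S - ((x0 + x0) * w0 + (x1 + y0) * w1)))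
   - (E * r0 + M * r1 - (t + Q - ((y0 + y0) * v0 + (y1 + z0) * v1)))
   + (E * u0 + M * u1 - x0) * w0 + (E * v0 + M * v1 - y0) * w1
   - (E * v0' + M * v1' - y0) * v0 - (E * w0 + M * w1 - z0) * v1)
  + ((E * G - M ^+ 2) * S + h * l
     - (G * (x0 * z0) - M * (x0 * z1 + x1 * z0) + E * (x1 * z1)))
  - ((E * G - M ^+ 2) * Q + k * k
     - (G * (y0 * y0) - M * (y0 * y1 + y1 * y0) + E * (y1 * y1)))
  - x0 * (G * (E * w0 + M * w1 - z0) - M * (M * w0 + G * w1 - z1))
  - x1 * (E * (M * w0 + G * w1 - z1) - M * (E * w0 + M * w1 - z0))
  + y0 * (G * (E * v0 + M * v1 - y0) - M * (M * v0 + G * v1 - y1))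
  + y1 * (E * (M * v0 + G * v1 - y1) - M * (E * v0 + M * v1 - y0))).
  by ring.
by rewrite A B G00 G01 G10 G11 H01 H11 gA gB; ring.
Qed.

Section GaussEquation.
(* [F1 i], [F2 i j] and [F3 i j k] are the iterated partial derivatives of a
   parametrized surface in Minkowski space, the first index being the last
   differentiation. *)
Context (R : realType) (D : set 'rV[R]_2) (F1 : 'I_2 -> 'rV[R]_2 -> 'rV[R]_3)
  (F2 : 'I_2 -> 'I_2 -> 'rV[R]_2 -> 'rV[R]_3)
  (F3 : 'I_2 -> 'I_2 -> 'I_2 -> 'rV[R]_2 -> 'rV[R]_3)
  (g : 'rV[R]_2 -> 'M[R]_2).
Let e (i : 'I_2) : 'rV[R]_2 := delta_mx 0 i.
Hypotheses (D_open : open D)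
  (is_derive_F1 : forall i j q, D q -> is_derive q (e i) (F1 j) (F2 i j q))
  (is_derive_F2 : forall i j k q, D q ->
    is_derive q (e i) (F2 j k) (F3 i j k q))
  (F2C : forall i j q, D q -> F2 i j q = F2 j i q)
  (F3C : forall i j k q, D q -> F3 i j k q = F3 j i k q)
  (g_induced : forall q, D q -> forall i j,
    g q i j = lorentz (F1 i q) (F1 j q))
  (g_unit : forall q, D q -> g q \in unitmx).

Let is_derive_g i j k q : D q -> is_derive q (e i) (fun z => g z j k)
  (lorentz (F2 i j q) (F1 k q) + lorentz (F1 j q) (F2 i k q)).
Proof.
move=> Dq.
have H := is_derive_lorentz (is_derive_F1 i j Dq) (is_derive_F1 i k Dq).
apply: near_eq_is_derive H.
by apply: filterS (open_nbhs_nbhs (conj D_open Dq)) => z Dz; rewrite g_induced.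
Qed.

(* The Christoffel symbols of the first kind are the tangential components of
   the second derivatives of the parametrization. *)
Lemma christoffel_lower i j m q : D q ->
  \sum_(k < 2) g q m k * christoffel g k i j q = lorentz (F2 i j q) (F1 m q).
Proof.
move=> Dq.
pose b := \col_l lorentz (F2 i j q) (F1 l q) : 'cV[R]_2.
transitivity ((g q *m (invmx (g q) *m b)) m 0); last first.
  by rewrite mulKVmx ?g_unit// mxE.
rewrite [RHS]mxE.
apply: eq_bigr => k _; rewrite mxE; congr (_ * _).
rewrite /christoffel big_distrr; apply: eq_bigr => l _ /=.
have pdg r s t : pd r (fun z => g z s t) q
    = lorentz (F2 r s q) (F1 t q) + lorentz (F1 s q) (F2 r t q).
  by have [_] := is_derive_g r s t Dq.
rewrite mxE !pdg mulrCA; congr (_ * _).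
(* By symmetry of [F2], four of the six products cancel and the other two agree, which absorbs the
   factor 1/2. *)
rewrite (F2C j i)// (F2C l j)// (F2C l i)//.
rewrite (lorentzC (F1 j q) (F2 i l q)).
set x := lorentz (F2 i j q) _; set y := lorentz (F2 i l q) _.
by set z := lorentz (F1 i q) _; clearbody x y z; field.
Qed.

Let detg q := g q 0 0 * g q 1 1 - g q 0 1 * g q 1 0.

Let detgE q : \det (g q) = detg q.
Proof. exact: det_mx2. Qed.

Let detg_neq0 q : D q -> detg q != 0.
Proof. by move/g_unit; rewrite unitmxE unitfE detgE. Qed.

(* Indices are in Z/2, so 1 - k is the other index: this is Cramer's rule. *)
Let christoffelE k i j q : D q -> christoffel g k i j q
  = (g q (1 - k) (1 - k) * lorentz (F2 i j q) (F1 k q)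
     - g q k (1 - k) * lorentz (F2 i j q) (F1 (1 - k) q)) / detg q.
Proof.
move=> Dq; apply/(canRL (mulfK (detg_neq0 Dq))).
rewrite -!christoffel_lower// !big_ord2 /detg.
have [->|->] : k = 0 \/ k = 1.
- by case: k => -[|[|//]] ?; [left|right]; apply/val_inj.
- by rewrite subr0; ring.
- by rewrite subrr; ring.
Qed.

(** Near [q], Cramer's rule exhibits the symbol as a quotient of derivable functions, so the matrix
    inverse need not be differentiated. *)
Let derivable_christoffel k i j l q : D q ->
  derivable (christoffel g k i j) q (e l).
Proof.
move=> Dq.
have dg a b : derivable (fun z => g z a b : R) q (e l).
  by have [] := is_derive_g l a b Dq.
have dF a : derivable (fun z => lorentz (F2 i j z) (F1 a z)) q (e l).
  by have [] := is_derive_lorentz (is_derive_F2 l i j Dq) (is_derive_F1 l a Dq).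
have ddet : derivable (fun z => (detg z)^-1) q (e l).
  apply: derivableV; first exact: detg_neq0.
  exact: derivableB (derivableM (dg 0 0) (dg 1 1))
    (derivableM (dg 0 1) (dg 1 0)).
have H := derivableM (derivableB (derivableM (dg (1 - k) (1 - k)) (dF k))
  (derivableM (dg k (1 - k)) (dF (1 - k)))) ddet.
apply: near_eq_derivable H.
apply: filterS (open_nbhs_nbhs (conj D_open Dq)) => z Dz.
by rewrite christoffelE.
Qed.

(** Differentiate [christoffel_lower] by the product rule and solve for the terms containing
    derivatives of the symbols. *)
Lemma christoffel_lower_derive a i j m q : D q ->
  \sum_(k < 2) g q m k * pd a (christoffel g k i j) q =
  lorentz (F3 a i j q) (F1 m q) + lorentz (F2 i j q) (F2 a m q)
  - \sum_(k < 2) (lorentz (F2 a m q) (F1 k q) + lorentz (F1 m q) (F2 a k q))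
      * christoffel g k i j q.
Proof.
move=> Dq.
have L : is_derive q (e a) (fun z => lorentz (F2 i j z) (F1 m z))
    (\sum_(k < 2) ((lorentz (F2 a m q) (F1 k q) + lorentz (F1 m q) (F2 a k q))
      * christoffel g k i j q + g q m k * pd a (christoffel g k i j) q)).
  have H k := is_derive_mul (is_derive_g a m k Dq)
    (derivableP (@derivable_christoffel k i j a q Dq)).
  have := is_derive_sum H.
  apply: near_eq_is_derive.
  apply: filterS (open_nbhs_nbhs (conj D_open Dq)) => z Dz.
  by rewrite fct_sumE christoffel_lower.
have [_] := is_derive_lorentz (is_derive_F2 a i j Dq) (is_derive_F1 a m Dq).
by have [_ ->] := L; rewrite big_split => <- /=; rewrite addrAC subrr add0r.
Qed.

(** One factor [\det (g q)] clears the denominator of the curvature; the other lets [lorentz_gram]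
    split products of second derivatives into tangential and normal parts. *)
Lemma gauss_equation q : D q ->
  gauss_curvature g q * \det (g q) ^+ 2 =
  triple (F1 0 q) (F1 1 q) (F2 0 1 q) ^+ 2
  - triple (F1 0 q) (F1 1 q) (F2 0 0 q) * triple (F1 0 q) (F1 1 q) (F2 1 1 q).
Proof.
move=> Dq; have dn0 := detg_neq0 Dq.
rewrite /gauss_curvature expr2 mulrA divfK ?detgE//.
(* [A] and [B] lower the index of the two derivative terms of [riemann l 1 0 1]. *)
have A := christoffel_lower_derive 0 1 1 0 Dq.
have B := christoffel_lower_derive 1 0 1 0 Dq.
have gC : g q 1 0 = g q 0 1 by rewrite !g_induced// lorentzC.
have lower i j m := christoffel_lower i j m Dq.
have G00 := lower 0 0 0; have G01 := lower 0 1 0.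
have G10 := lower 1 0 0; have G11 := lower 1 1 0.
have H01 := lower 0 1 1; have H11 := lower 1 1 1.
rewrite 2!big_ord2 in A; rewrite 2!big_ord2 in B.
rewrite big_ord2 in G00; rewrite big_ord2 in G01.
rewrite big_ord2 in G10; rewrite big_ord2 in G11.
rewrite big_ord2 in H01; rewrite big_ord2 in H11.
rewrite big_ord2 /riemann 2!big_ord2.
(* The third derivative in [B] becomes the one in [A], so that they cancel. *)
rewrite (F2C 1 0 Dq) in G10 B; rewrite (F3C 1 0 1 Dq) in B.
have gram := lorentz_gram (F1 0 q) (F1 1 q).
rewrite -!g_induced// in gram.
have gramA := gram (F2 0 0 q) (F2 1 1 q).
have gramB := gram (F2 0 1 q) (F2 0 1 q).
rewrite (lorentzC (F1 0 q) (F2 0 0 q)) in A.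
rewrite (lorentzC (F1 0 q) (F2 0 1 q)) in A B.
rewrite (lorentzC (F1 0 q) (F2 1 1 q)) in B.
rewrite (lorentzC (F2 1 1 q) (F2 0 0 q)) in A.
rewrite gC in H01 H11 *.
by rewrite /detg gC (gauss_algebra A B G00 G01 G10 G11 H01 H11 gramA gramB).
Qed.

End GaussEquation.

(** * The second fundamental form under the angle condition *)

Lemma constant_angle_second_form (R : realType) (D : set 'rV[R]_2)
    (F1 : 'I_2 -> 'rV[R]_2 -> 'rV[R]_3)
    (F2 : 'I_2 -> 'I_2 -> 'rV[R]_2 -> 'rV[R]_3) (U : 'rV[R]_3) (C : R)
    (d := fun q => lorentz (F1 0 q) (F1 0 q) * lorentz (F1 1 q) (F1 1 q)
       - lorentz (F1 0 q) (F1 1 q) ^+ 2) :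
  open D ->
  (forall i j q, D q -> is_derive q (delta_mx 0 i) (F1 j) (F2 i j q)) ->
  (forall i j q, D q -> F2 i j q = F2 j i q) ->
  (forall q, D q -> 0 < lorentz (F1 0 q) (F1 0 q)) ->
  (forall q, D q -> 0 < d q) ->
  lorentz U U = -1 -> 0 < C ->
  (forall q, D q -> triple (F1 0 q) (F1 1 q) U ^+ 2 = C * d q) ->
  forall q, D q ->
  triple (F1 0 q) (F1 1 q) (F2 0 1 q) ^+ 2
  = triple (F1 0 q) (F1 1 q) (F2 0 0 q) * triple (F1 0 q) (F1 1 q) (F2 1 1 q).
Proof.
move=> D_open dF1 F2C Epos dpos UU C0 angle q Dq.
pose h i j := triple (F1 0 q) (F1 1 q) (F2 i j q).
rewrite -!/(h _ _).
have n_neq0 : triple (F1 0 q) (F1 1 q) U != 0.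
  by rewrite -sqrf_eq0 angle// mulf_neq0 ?gt_eqF ?dpos.
(* X / d and Y / d are the coordinates of the tangential part of [U] in the basis [F1 0 q],
   [F1 1 q]. *)
pose X := lorentz (F1 1 q) (F1 1 q) * lorentz U (F1 0 q)
  - lorentz (F1 0 q) (F1 1 q) * lorentz U (F1 1 q).
pose Y := lorentz (F1 0 q) (F1 0 q) * lorentz U (F1 1 q)
  - lorentz (F1 0 q) (F1 1 q) * lorentz U (F1 0 q).
have kernel i : h i 0 * X + h i 1 * Y = 0.
  have dn := is_derive_triple U (dF1 i 0 q Dq) (dF1 i 1 q Dq).
  have dE := is_derive_lorentz (dF1 i 0 q Dq) (dF1 i 0 q Dq).
  have dM := is_derive_lorentz (dF1 i 0 q Dq) (dF1 i 1 q Dq).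
  have dG := is_derive_lorentz (dF1 i 1 q Dq) (dF1 i 1 q Dq).
  have [_ L] := is_derive_mul dn dn.
  have [_] := is_derive_mul (is_derive_cst C q (delta_mx 0 i))
    (is_deriveB (is_derive_mul dE dG) (is_derive_mul dM dM)).
  have -> : 'D_(delta_mx 0 i) (fun z => cst C z *
      ((fun z => lorentz (F1 0 z) (F1 0 z) * lorentz (F1 1 z) (F1 1 z))
       - (fun z => lorentz (F1 0 z) (F1 1 z) * lorentz (F1 0 z) (F1 1 z))) z) q
     = 'D_(delta_mx 0 i) (fun z => triple (F1 0 z) (F1 1 z) U
         * triple (F1 0 z) (F1 1 z) U) q.
    apply: near_eq_derive.
    by apply: filterS (open_nbhs_nbhs (conj D_open Dq)) => z Dz /=;
      rewrite -expr2 angle// /d expr2.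
  rewrite L !fctE mul0r add0r => {}L.
  have := triple_gram (F1 0 q) (F1 1 q) (F2 i 0 q) (F2 i 1 q) U.
  rewrite -/(h i 0) -/(h i 1) -/X -/Y -/(d q) => T.
  have A := angle q Dq.
  apply/(mulfI n_neq0); rewrite mulr0 -[LHS]opprK -mulrN -T; apply/eqP.
  rewrite oppr_eq0; apply/eqP.
  move: L A.
  rewrite (lorentzC (F1 0 q) (F2 i 0 q)) (lorentzC (F1 1 q) (F2 i 1 q)).
  move: (triple (F1 0 q) (F1 1 q) U) (d q) => n dq.
  (* [m] is the derivative of [n], and [s] is half that of [d]; halving the differentiated angle
     relation gives n m = C s. *)
  set m := triple _ _ _ + _; set s := _ + _ - _ * (_ + _).
  move=> L n2; have {}L : n * m = C * s by rewrite /s; lra.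
  transitivity (dq * (n * m) - s * n ^+ 2); first by ring.
  by rewrite L n2; ring.
have hC : h 1 0 = h 0 1 by rewrite /h (F2C 1 0 q Dq).
have h11 := kernel 0; have := kernel 1; rewrite hC => h01.
(* Eliminate [Y], then [X], from the two kernel equations. *)
have HX : (h 0 1 ^+ 2 - h 0 0 * h 1 1) * X = 0.
  transitivity (h 0 1 * (h 0 1 * X + h 1 1 * Y)
    - h 1 1 * (h 0 0 * X + h 0 1 * Y)).
    by ring.
  by rewrite h01 h11; ring.
have HY : (h 0 1 ^+ 2 - h 0 0 * h 1 1) * Y = 0.
  transitivity (h 0 1 * (h 0 0 * X + h 0 1 * Y)
    - h 0 0 * (h 0 1 * X + h 1 1 * Y)).
    by ring.
  by rewrite h01 h11; ring.
have [/eqP|det_neq0] := eqVneq (h 0 1 ^+ 2 - h 0 0 * h 1 1) 0.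
  by rewrite subr_eq0 => /eqP.
have X0 : X = 0 by apply/(mulfI det_neq0); rewrite HX mulr0.
have Y0 : Y = 0 by apply/(mulfI det_neq0); rewrite HY mulr0.
(* The right side is d times the squared length of the tangential part of [U]; that squared length
   is thus the constant C - 1, and its vanishing at [q] spreads to all of [D]. *)
have gramUU z : D z -> (C - 1) * d z =
    lorentz (F1 1 z) (F1 1 z) * lorentz U (F1 0 z) ^+ 2
    - lorentz (F1 0 z) (F1 1 z)
      * (2 * (lorentz U (F1 0 z) * lorentz U (F1 1 z)))
    + lorentz (F1 0 z) (F1 0 z) * lorentz U (F1 1 z) ^+ 2.
  move=> Dz; have := lorentz_gram (F1 0 z) (F1 1 z) U U.
  by rewrite -expr2 angle// UU -/(d z) => H; lra.
have C1 : C = 1.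
  have H : (C - 1) * d q = 0.
    transitivity (X * lorentz U (F1 0 q) + Y * lorentz U (F1 1 q)).
      by rewrite gramUU// /X /Y; ring.
    by rewrite X0 Y0; ring.
  by move/eqP: H; rewrite mulf_eq0 (gt_eqF (dpos _ Dq)) orbF subr_eq0 => /eqP.
have U_normal j z : D z -> lorentz (F1 j z) U = 0.
  move=> Dz; rewrite lorentzC; have := gramUU z Dz; rewrite C1 subrr mul0r.
  have := dpos z Dz; have := Epos z Dz; rewrite /d.
  set E := lorentz (F1 0 z) (F1 0 z); set M := lorentz (F1 0 z) (F1 1 z).
  set G := lorentz (F1 1 z) (F1 1 z).
  set p := lorentz U (F1 0 z); set r := lorentz U (F1 1 z) => E0 d0 Q.
  (* Complete the square after multiplying the quadratic form by [E]. *)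
  have S : (E * G - M ^+ 2) * p ^+ 2 + (E * r - M * p) ^+ 2 = 0.
    by rewrite -[RHS](mulr0 E) Q; ring.
  have p0 : p = 0.
    have dp : 0 <= (E * G - M ^+ 2) * p ^+ 2.
      by rewrite mulr_ge0 ?sqr_ge0 ?(ltW d0).
    move/eqP: S; rewrite (paddr_eq0 dp (sqr_ge0 _)).
    by rewrite mulf_eq0 (gt_eqF d0) sqrf_eq0 => /andP[/eqP].
  have r0 : r = 0.
    have /eqP : E * r ^+ 2 = 0 by rewrite [RHS]Q p0; ring.
    by rewrite mulf_eq0 (gt_eqF E0) sqrf_eq0 => /eqP.
  have [->//|->//] : j = 0 \/ j = 1.
  by case: j => -[|[|//]] ?; [left|right]; apply/val_inj.
(* Differentiate the relation [U_normal], valid on the open set [D]. *)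
have U_normal2 i j : lorentz (F2 i j q) U = 0.
  have [_] := is_derive_lorentz (dF1 i j q Dq)
    (is_derive_cst U q (delta_mx 0 i)).
  have -> : lorentz (F1 j q) 0 = 0 by rewrite /lorentz !mxE; ring.
  rewrite addr0 => <-; rewrite -[RHS](derive_cst (0 : R) q (delta_mx 0 i)).
  apply: near_eq_derive.
  by apply: filterS (open_nbhs_nbhs (conj D_open Dq)) => z Dz; exact: U_normal.
(* In [lorentz_gram] only the product of the two triples survives, and the one with [U] is
   nonzero. *)
have h0 i j : h i j = 0.
  have := lorentz_gram (F1 0 q) (F1 1 q) U (F2 i j q).
  rewrite (lorentzC U (F2 i j q)) U_normal2 !(lorentzC U (F1 _ q)) !U_normal//.
  rewrite !(mulr0, mul0r, addr0, add0r, oppr0) => /eqP.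
  by rewrite mulf_eq0 (negPf n_neq0) => /eqP.
by rewrite !h0 expr0n mulr0.
Qed.

(** * Passage from the surface to a chart *)

(** The form takes the value [A 0 0] at (1, 0) and [A 0 0 * \det A] at (- A 0 1, A 0 0). *)
Lemma posdef2_det (R : realType) (A : 'M[R]_2) :
  A 1 0 = A 0 1 ->
  (forall v : 'rV[R]_2, v != 0 -> 0 < (v *m A *m v^T) 0 0) ->
  0 < A 0 0 /\ 0 < \det A.
Proof.
move=> AC Apos.
have form (v : 'rV[R]_2) : (v *m A *m v^T) 0 0
    = v 0 0 ^+ 2 * A 0 0 + 2 * (v 0 0 * v 0 1 * A 0 1) + v 0 1 ^+ 2 * A 1 1.
  by rewrite mxE big_ord2 !mxE !big_ord2 AC; ring.
have E0 : 0 < A 0 0.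
  have /Apos : delta_mx 0 0 != 0 :> 'rV[R]_2.
    by apply/eqP => /rowP/(_ 0)/eqP; rewrite !mxE/= oner_eq0.
  by rewrite form !mxE/= !(mul0r, mulr0, addr0, expr0n, expr1n, mul1r).
split=> //; pose v : 'rV[R]_2 := \row_i if i == 0 then - A 0 1 else A 0 0.
have /Apos : v != 0.
  by apply/eqP => /rowP/(_ 1)/eqP; rewrite !mxE/= gt_eqF.
rewrite form !mxE/= => H; rewrite -(pmulr_rgt0 _ E0) det_mx2 AC.
by congr (_ < _): H; ring.
Qed.

Lemma lorentz_unit_timelike (R : realType) (w : 'rV[R]_3) :
  timelike w -> lnorm w = 1 -> lorentz w w = -1.
Proof.
move=> wt w1; have := sqr_sqrtr (normr_ge0 (lorentz w w)).
by rewrite -/(lnorm w) w1 expr1n ltr0_norm// => /(congr1 -%R); rewrite opprK.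
Qed.

(* n is the normal of [triple a b]; xi is a multiple of n, and
   lorentz n n = - d. *)
Lemma unit_normal_triple (R : realType) (a b xi U : 'rV[R]_3)
    (d := lorentz a a * lorentz b b - lorentz a b ^+ 2) :
  d != 0 -> lorentz xi xi = -1 -> lorentz xi a = 0 -> lorentz xi b = 0 ->
  triple a b U ^+ 2 = lorentz xi U ^+ 2 * d.
Proof.
move=> d0 xixi xia xib.
have := lorentz_gram a b xi xi; have := lorentz_gram a b xi U.
rewrite xixi xia xib -/d !(mul0r, mulr0, subr0, addr0) => /eqP.
rewrite addr_eq0 => /eqP xiU /eqP; rewrite addr_eq0 => /eqP xi2.
apply/(mulfI d0); transitivity ((d * lorentz xi U) ^+ 2); last by ring.
rewrite xiU sqrrN exprMn; congr (_ * _).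
by rewrite expr2; move: xi2; lra.
Qed.

Theorem proposition3p5 (R : realType) (M : smooth_surface R)
    (M_connected : connected [set: M]) (x : M -> 'rV[R]_3)
    (x_immersion : smooth_immersion x) (x_spacelike : spacelike x)
    (x_constant_angle : constant_angle x) :
  flat x.
Proof.
have [xi [U [theta [[xi_unit xi_normal] U1 [Ut _] angle]]]] := x_constant_angle.
move=> c Ac q Dq.
have [F_smooth _] := x_immersion c Ac.
set D := chart_cod c in Dq F_smooth; set F := local_expr x c in F_smooth.
have D_open : open D := @chart_cod_open _ _ c.
pose g := induced_metric x c.
pose F1 (i : 'I_2) : 'rV[R]_2 -> 'rV[R]_3 := 'D_(delta_mx 0 i) F.
pose F2 (i j : 'I_2) : 'rV[R]_2 -> 'rV[R]_3 := 'D_(delta_mx 0 i) (F1 j).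
pose F3 (i j k : 'I_2) : 'rV[R]_2 -> 'rV[R]_3 := 'D_(delta_mx 0 i) (F2 j k).
(* Classes C^1, C^2 and C^3 make [F], [F1] and [F2] differentiable in turn. *)
have [dF _] := F_smooth 1.
have d2F i z : D z -> differentiable (F1 i) z.
  by have [_ /(_ (delta_mx 0 i))[+ _]] := F_smooth 2; exact.
have d3F i j z : D z -> differentiable (F2 i j) z.
  have [_ /(_ (delta_mx 0 j))[_ /(_ (delta_mx 0 i))[+ _]]] := F_smooth 3.
  exact.
have dF1 i j z : D z -> is_derive z (delta_mx 0 i) (F1 j) (F2 i j z).
  by move=> /d2F => /(_ j) H; exact/derivableP/diff_derivable.
have dF2 i j k z : D z -> is_derive z (delta_mx 0 i) (F2 j k) (F3 i j k z).
  by move=> /d3F => /(_ j k) H; exact/derivableP/diff_derivable.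
have F2C i j z : D z -> F2 i j z = F2 j i z.
  move=> Dz; have [_ dd] := F_smooth 2.
  have d2 w : differentiable ('D_w F) z by have [+ _] := dd w; exact.
  exact: (derive_commute (delta_mx 0 j) (delta_mx 0 i) D_open Dz dF d2).
have F3C i j k z : D z -> F3 i j k z = F3 j i k z.
  move=> Dz; have [_ /(_ (delta_mx 0 k))[_ dd]] := F_smooth 3.
  have d2 w : differentiable ('D_w (F1 k)) z by have [+ _] := dd w; exact.
  exact: (derive_commute (delta_mx 0 j) (delta_mx 0 i) D_open Dz (d2F k) d2).
have rowF i z : D z -> row i (jacobian F z) = F1 i z.
  by move=> /dF dFz; rewrite rowE -deriveEjacobian.
have gE z : D z -> forall i j, g z i j = lorentz (F1 i z) (F1 j z).
  by move=> Dz i j; rewrite mxE -/F !rowF.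
have g_pos z : D z -> forall v, v != 0 -> 0 < (v *m g z *m v^T) 0 0 :=
  x_spacelike c Ac z.
have xi_F1 z i : D z -> lorentz (xi (chart_inv c z)) (F1 i z) = 0.
  by move=> Dz; rewrite -rowF// rowE; exact: xi_normal.
rewrite -/g; clearbody D g F3 F2 F1.
have gC z : D z -> g z 1 0 = g z 0 1 by move=> Dz; rewrite !gE// lorentzC.
have gpos z : D z -> 0 < g z 0 0 /\ 0 < \det (g z).
  by move=> Dz; apply: posdef2_det (gC z Dz) (g_pos z Dz).
have Epos z : D z -> 0 < lorentz (F1 0 z) (F1 0 z).
  by move=> Dz; rewrite -gE//; have [] := gpos z Dz.
pose d z := lorentz (F1 0 z) (F1 0 z) * lorentz (F1 1 z) (F1 1 z)
  - lorentz (F1 0 z) (F1 1 z) ^+ 2.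
have detE z : D z -> \det (g z) = d z.
  by move=> Dz; rewrite det_mx2 gC// -expr2 !gE.
have dpos z : D z -> 0 < d z.
  by move=> Dz; rewrite -detE//; have [] := gpos z Dz.
have g_unit z : D z -> g z \in unitmx.
  by move=> Dz; rewrite unitmxE unitfE detE// gt_eqF ?dpos.
have UU := lorentz_unit_timelike Ut U1.
(* For unit vectors the angle condition reads <xi, U> = - cosh theta; positivity of [C] comes from
   <xi, U> < 0. *)
pose C := cosh theta ^+ 2.
have xiU p : lorentz (xi p) U ^+ 2 = C /\ 0 < C.
  have [xi1 [xit _]] := xi_unit p.
  have [_ _ xiU0 _ xiUE] := angle p.
  have e : lorentz (xi p) U ^+ 2 = C by rewrite xiUE xi1 U1 !mul1r sqrrN.
  by split=> //; rewrite -e lt0r sqrf_eq0 sqr_ge0 lt_eqF.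
have C0 : 0 < C by have [] := xiU (chart_inv c q).
have nU z : D z -> triple (F1 0 z) (F1 1 z) U ^+ 2 = C * d z.
  move=> Dz; have [<- _] := xiU (chart_inv c z).
  have [xi1 [xit _]] := xi_unit (chart_inv c z).
  apply: unit_normal_triple; rewrite ?xi_F1//; first by rewrite gt_eqF ?dpos.
  exact: lorentz_unit_timelike.
have K := gauss_equation D_open dF1 dF2 F2C F3C gE g_unit Dq.
have h := constant_angle_second_form D_open dF1 F2C Epos dpos UU C0 nU Dq.
move: K; rewrite h subrr detE// => /eqP.
by rewrite mulf_eq0 sqrf_eq0 (gt_eqF (dpos _ Dq)) orbF => /eqP.
Qed.
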